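(* Let $G$ be a modular abelian independence group. Then $G$ has the matching property if and only if, for every pair of nonempty finite-rank subsets $X,Y$ of $G$, $$\rho(XY)\geq\min\bigl\{\rho(G),\rho(X)+\rho(Y)-1\bigr\}.$$
   Context: A finitary matroid is a pair $(E,\mathcal{I})$ consisting of a set $E$ and a nonempty collection $\mathcal{I}$ of subsets of $E$ (called the independent sets) such that: (I1) if $A\in\mathcal{I}$ and $B\subseteq A$ then $B\in\mathcal{I}$; (I2) if $A,B$ are finite elements of $\mathcal{I}$ with $|B|=|A|+1$, then there is $x\in B\setminus A$ with $\{x\}\cup A\in\mathcal{I}$; (I3) if $A\subseteq E$ and every finite subset of $A$ belongs to $\mathcal{I}$, then $A\in\mathcal{I}$. The collection $\mathcal{I}$ is called an independence structure on $E$. A basis of a subset $A\subseteq E$ is an inclusion-maximal independent subset of $A$; any two bases of $A$ have the same cardinality, and the rank $\rho(A)$ is that cardinal number; $A$ has finite rank if $\rho(A)$ is a nonnegative integer. An element $x\in E$ depends on $A\subseteq E$ if either $x\in A$, or $x\notin A$ and $\{x\}\cup B\notin\mathcal{I}$ for some independent $B\subseteq A$. The closure is $\operatorname{cl}(A)=\{x\in E: x\text{ depends on }A\}$, and $A$ is a flat if $\operatorname{cl}(A)=A$. The finitary matroid is modular if $\rho(A)+\rho(B)=\rho(A\cup B)+\rho(A\cap B)$ (as cardinals) for all flats $A,B$. An independence group is a group $G$ (written multiplicatively, with identity $1$) together with an independence structure $\mathcal{I}$ on the set $G$ such that for every $g\in G$ and $A\subseteq G$ one has $gA\in\mathcal{I}$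 if and only if $A\in\mathcal{I}$, where $gA=\{gx:x\in A\}$. A modular abelian independence group is an independence group that is modular as a finitary matroid and whose group is abelian. For $X,Y\subseteq G$, $XY=\{xy:x\in X,y\in Y\}$. Let $A,B$ be subsets of $G$ with $\rho(A)=\rho(B)$ finite. $A$ is matched to $B$ if for every basis $\mathcal{A}$ of $A$ and every basis $\mathcal{B}$ of $B$ there exists a bijection $f:\mathcal{A}\to\mathcal{B}$ such that $af(a)\notin A$ for all $a\in\mathcal{A}$. The independence group $G$ has the matching property if for every pair $(A,B)$ of finite-rank flats of $G$ with $\rho(A)=\rho(B)$ and $1\notin B$, $A$ is matched to $B$. *)

(* Defs.v *)
From HB Require Import structures.
From mathcomp Require Import all_boot finmap.
From mathcomp Require Import boolp classical_sets functions cardinality.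

Set Implicit Arguments.
Unset Strict Implicit.
Unset Printing Implicit Defensive.

Local Open Scope classical_set_scope.
Local Open Scope card_scope.

(* Cardinal numbers are represented by sets (over possibly different types),
   to be compared only through #= and #<=.                                   *)
Definition card_add (T U : Type) (A : set T) (B : set U) : set (T + U) :=
  inl @` A `|` inr @` B.

Definition card_min (T U : Type) (A : set T) (B : set U) : set (T + U) :=
  if A #<= B then inl @` A else inr @` B.

Record finitary_matroid (E : Type) := FinitaryMatroid {
  indep : set (set E);
  indep_neq0 : indep !=set0;
  indep_sub : forall A B, indep A -> B `<=` A -> indep B;
  indep_exch : forall (A B : set E) (n : nat), indep A -> indep B ->
    A #= `I_n -> B #= `I_n.+1 ->
    exists x, (B `\` A) x /\ indep ([set x] `|` A);
  indep_finitary : forall A,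
    (forall B, B `<=` A -> finite_set B -> indep B) -> indep A
}.

Section matroid.
Variables (E : Type) (M : finitary_matroid E).
Implicit Types A B C : set E.

Definition is_basis A B :=
  [/\ B `<=` A, indep M B &
      forall C, indep M C -> B `<=` C -> C `<=` A -> C = B].

(* The cardinal of rank A is the rank of A; bases exist by Zorn's lemma, so
   the default value set0 is never used for lack of a basis: see rankP.      *)
Definition rank A : set E := xget set0 [set B | is_basis A B].

Lemma ex_basis A : exists B, is_basis A B.
Proof.
have I0 : indep M set0.
  by have [X IX] := indep_neq0 M; exact: indep_sub IX (@sub0set _ _).
have [B [[BA IB] Bmax]] :
    exists B, (B `<=` A /\ indep M B) /\
      forall C, B `<` C -> ~ (C `<=` A /\ indep M C).
  apply: (@Zorn_bigcup _ (fun B => B `<=` A /\ indep M B)) => F FP Ftot.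
  split; first by move=> x [X /FP[XA _] /XA].
  apply: indep_finitary => C CF /finite_setP[n].
  move=> /card_set_bijP[g [gC ginj _]].
  have chain k : exists2 X, X = set0 \/ F X &
      forall c, C c -> (g c < k)%N -> X c.
    elim: k => [|k [X FX Xk]]; first by exists set0 => //; left.
    have [[c [Cc gck]]|nex] := pselect (exists c, C c /\ g c = k); last first.
      exists X => // c Cc; rewrite ltnS leq_eqVlt => /orP[/eqP gck|/Xk]; last exact.
      by case: nex; exists c.
    have [Y FY Yc] := CF c Cc.
    have gc c' : C c' -> g c' = k -> c' = c.
      by move=> Cc' gc'; apply: ginj; rewrite ?inE// gck.
    have [YX|XY] : Y `<=` X \/ X `<=` Y.
      by case: FX => [->|FX]; [right; exact: sub0set | exact: Ftot].
    - exists X => // c' Cc'; rewrite ltnS leq_eqVlt => /orP[/eqP|/Xk]; last exact.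
      by move=> /(gc _ Cc') ->; exact: YX.
    - exists Y; first by right.
      move=> c' Cc'; rewrite ltnS leq_eqVlt => /orP[/eqP|].
        by move=> /(gc _ Cc') ->.
      by move=> /(Xk _ Cc'); exact: XY.
  have [X FX Xn] := chain n.
  have CX : C `<=` X by move=> c Cc; apply: Xn => //; exact: gC.
  by case: FX => [X0|/FP[_ IX]]; [rewrite X0 in CX|]; exact: indep_sub CX.
exists B; split=> // C IC BC CA; apply: contrapT => CneB.
by apply: (Bmax C) => //; rewrite properEneq; split=> //; apply/eqP => /esym.
Qed.

Lemma rankP A : is_basis A (rank A).
Proof. exact: (@xgetPex _ set0 (is_basis A) (ex_basis A)). Qed.

Definition finite_rank A := finite_set (rank A).

Definition depends (x : E) A :=
  A x \/ (~ A x /\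
    exists B, [/\ indep M B, B `<=` A & ~ indep M ([set x] `|` B)]).

Definition cl A : set E := [set x | depends x A].

Definition is_flat A := cl A = A.

Definition modular := forall A B, is_flat A -> is_flat B ->
  card_add (rank A) (rank B) #= card_add (rank (A `|` B)) (rank (A `&` B)).

End matroid.

(* A natural number, meaningful only when finite_rank M A holds. *)
Definition nrank (E : choiceType) (M : finitary_matroid E) (A : set E) : nat :=
  #|` fset_set (rank M A)|.

Section independence_group.
Variables (G : groupType) (M : finitary_matroid G).
Implicit Types A B X Y : set G.

Definition ltranslate (g : G) A : set G := [set (g * x)%g | x in A].

Definition setprod X Y : set G := [set (x * y)%g | x in X & y in Y].

Definition independence_group :=
  forall (g : G) A, indep M (ltranslate g A) <-> indep M A.

Definition abelian_group := forall x y : G, (x * y = y * x)%g.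

Definition modular_abelian_independence_group :=
  [/\ independence_group, modular M & abelian_group].

(* Only meaningful when A and B have the same finite rank. *)
Definition matched A B := forall a b, is_basis M A a -> is_basis M B b ->
  exists f : G -> G, set_bij a b f /\ forall x, a x -> ~ A (x * f x)%g.

Definition matching_property := forall A B, is_flat M A -> is_flat M B ->
  finite_rank M A -> finite_rank M B -> rank M A #= rank M B ->
  ~ B 1%g -> matched A B.

End independence_group.

(* Main.v *)
Require Import Defs.
From mathcomp Require Import all_boot finmap.
From mathcomp Require Import boolp classical_sets functions cardinality.

Set Implicit Arguments.
Unset Strict Implicit.
Unset Printing Implicit Defensive.

Local Open Scope classical_set_scope.
Local Open Scope card_scope.

(** From the inequality to matchings ([rank_inequality_matching]): for bases
    [a], [b] of [A], [B], join [x] to [y] when [x y] is outside [A], and check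
    Hall's condition ([hall]).  If [S `<=` a] violates it, the set [T] of the
    elements of [b] without a neighbour in [S] has more than [n - #|S|]
    elements, where [n] is the common rank of [A] and [B].  Since [1] is not in
    the flat [B], the set [Y = 1 |` T] is still independent, while
    [S Y `<=` A].  The inequality for [S] and [Y] then forces the rank of [G]
    to be at most [n], so [B = G] contains [1], a contradiction.

    From matchings to the inequality ([matching_rank_inequality]): products
    and closures are compatible ([cl_setprod]), so [X] and [Y] may be replaced
    by flats [A] and [B], and [X Y] by a flat [C] containing [A B].  For
    [e = a / b] with [a] in [A] and [b] in [B], Dyson's transform replaces
    [A, B] by [cl (A `|` e B)] and [B `&` e^-1 A].  Modularity applied to the
    flats [A] and [e B] says exactly that the sum of the two ranks does not
    change, and the product of the new pair is still inside [C]; so one may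
    induct on the rank of [B] ([cauchy_davenport_flats]).

    The induction stops when [e B `<=` A] for all such [e].  Then
    [H = {h | A h `<=` A}] is a finite-rank flat, closed under multiplication,
    which contains a translate of [B].  If [B] has rank at most 1 the
    inequality is clear.  Otherwise [H] has rank at least 2, and the matching
    property forces [H = G] ([flat_submonoid_full]): given [x] outside [H] and
    a basis [1 |` h] of [H], the flat spanned by [x |` h] has the rank of [H]
    and misses [1], but an element of [h] times an element of [H] never leaves
    [H], so it cannot be matched.  From [H = G] one gets [A = C = G]. *)

(** * Hall's marriage theorem *)

Section hall.
Variables (T U : choiceType) (r : T -> U -> bool).
Implicit Types (S A : {fset T}) (B : {fset U}).
Local Open Scope fset_scope.

Definition neighbours S B : {fset U} := [fset y in B | has (r^~ y) S].

Lemma neighboursP S B y :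
  reflect (y \in B /\ exists2 x, x \in S & r x y) (y \in neighbours S B).
Proof. by rewrite !inE; apply: (iffP andP) => -[? /hasP]. Qed.

(** Halmos and Vaughan's induction on [#|A|].  Either some nonempty proper
    [S] is tight, and matching [S] into its neighbours leaves Hall's condition
    true for the rest; or there is no such [S], and then any edge can be
    used and removed, since it costs every other set at most one neighbour. *)
Lemma hall A B (u0 : U) :
    (forall S, S `<=` A -> #|` S| <= #|` neighbours S B|) ->
  exists f : T -> U,
    {in A &, injective f} /\ forall x, x \in A -> f x \in B /\ r x (f x).
Proof.
have [n] := ubnP #|` A|; elim: n A B => // n IH A B ltAn hallA.
have [->|/fset0Pn[a aA]] := eqVneq A fset0; first by exists (fun=> u0).
have [[S [S0 SA tight]]|loose] := pselect (exists S,
    [/\ S != fset0, S `<` A & #|` neighbours S B| <= #|` S|]).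
  set N := neighbours S B in tight.
  have SsubA := fproper_sub SA.
  have [||f1 [f1_inj f1P]] := IH S N.
  - exact: leq_trans (fproper_ltn_card SA) _.
  - move=> S' S'S; apply: leq_trans (hallA S' (fsubset_trans S'S SsubA)) _.
    apply: fsubset_leq_card; apply/fsubsetP => y /neighboursP[yB [x xS' rxy]].
    apply/neighboursP; split; last by exists x.
    by apply/neighboursP; split=> //; exists x => //; exact: (fsubsetP S'S).
  have [||f2 [f2_inj f2P]] := IH (A `\` S) (B `\` N).
  - rewrite cardfsDS//; apply: leq_trans (_ : #|` A| <= n); last exact: ltAn.
    rewrite ltn_subrL; by rewrite !cardfs_gt0 S0/=; apply/fset0Pn; exists a.
  - move=> S' S'AS.
    have S'S x : x \in S' -> (x \in A) && (x \notin S).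
      by move=> /(fsubsetP S'AS); rewrite inE andbC.
    have USA : S `|` S' `<=` A.
      by apply/fsubsetP => x; rewrite inE => /orP[/(fsubsetP SsubA)|/S'S/andP[]].
    have SS'0 : S `&` S' = fset0.
      apply/fsetP => x; rewrite !inE; apply/negbTE/andP => -[xS /S'S].
      by rewrite xS andbF.
    have := hallA _ USA; rewrite cardfsU SS'0 cardfs0 subn0 => le1.
    have le2 : neighbours (S `|` S') B `<=` N `|` neighbours S' (B `\` N).
      apply/fsubsetP => y /neighboursP[yB [x xU rxy]]; rewrite in_fsetU.
      have [//|yN /=] := boolP (y \in N).
      apply/neighboursP; split; first by rewrite inE yN.
      exists x => //; move: xU; rewrite inE => /orP[xS|//].
      by case/negP: yN; apply/neighboursP; split=> //; exists x.
    have := leq_trans le1 (leq_trans (fsubset_leq_card le2) (leq_card_fsetU _ _)).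
    by move=> le3; rewrite -(leq_add2l #|` S|); apply: leq_trans le3 _; rewrite leq_add2r.
  exists (fun x => if x \in S then f1 x else f2 x); split.
    have cross x y : x \in S -> y \in A -> y \notin S -> f1 x <> f2 y.
      move=> xS yA yS e; have [fN _] := f1P _ xS.
      have [] := f2P y; rewrite ?in_fsetD ?yS ?yA//.
      by rewrite -e fN.
    move=> x y xA yA; have [xS|xS] := boolP (x \in S);
        have [yS|yS] := boolP (y \in S).
    - exact: f1_inj.
    - by move/cross; case.
    - by move/esym/cross; case.
    - by apply: f2_inj; rewrite inE ?xS ?yS.
  move=> x xA; have [xS|xS] := boolP (x \in S).
    by have [/neighboursP[]] := f1P _ xS.
  by have [] := f2P x; rewrite ?inE ?xS// => /andP[].
have [b] : exists b, b \in neighbours [fset a] B.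
  apply/fset0Pn; rewrite -cardfs_gt0; apply: leq_trans (hallA _ _).
    by rewrite cardfs1.
  by rewrite fsub1set.
move=> /neighboursP[bB [_ /fset1P-> rab]].
have [||f [f_inj fP]] := IH (A `\ a) (B `\ b).
- by have := ltAn; rewrite (cardfsD1 a A) aA.
- move=> S SAa; have [->|S0] := eqVneq S fset0; first by rewrite cardfs0.
  have SA : S `<` A := fsub_proper_trans SAa (fproperD1 aA).
  have lt1 : #|` S| < #|` neighbours S B|.
    by rewrite ltnNge; apply/negP => le; apply: loose; exists S.
  have le2 : neighbours S B `<=` b |` neighbours S (B `\ b).
    apply/fsubsetP => y /neighboursP[yB xP]; rewrite in_fset1U.
    have [//|yb /=] := eqVneq y b.
    by apply/neighboursP; split=> //; rewrite !inE yb.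
  have := leq_trans lt1 (fsubset_leq_card le2).
  by rewrite cardfsU1 => /leq_trans/(_ (leq_add (leq_b1 _) (leqnn _))); rewrite add1n.
exists (fun x => if x == a then b else f x); split.
  have fb x : x \in A -> x != a -> f x != b.
    by move=> xA xa; have [] := fP x; rewrite !inE ?xa// => /andP[].
  move=> x y xA yA; have [->|xa] := eqVneq x a; have [->|ya] := eqVneq y a => //.
  - by move=> e; have /eqP[] := fb y yA ya.
  - by move=> e; have /eqP[] := fb x xA xa.
  - by apply: f_inj; rewrite !inE ?xa ?ya.
move=> x xA; have [->//|xa] := eqVneq x a.
by have [] := fP x; rewrite !inE ?xa// => /andP[].
Qed.
End hall.

(** * Finite cardinals *)

Section finite_cardinals.

Lemma card_gt0 (T : Type) (A : set T) n : A #= `I_n -> (0 < n)%N -> A !=set0.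
Proof. by case: n => // n /eq_cardSP[x Ax _] _; exists x. Qed.

Lemma card_setU1 (T : Type) (x : T) (A : set T) n :
  ~ A x -> A #= `I_n -> x |` A #= `I_n.+1.
Proof.
move=> nAx An; apply/eq_cardSP; exists x; first by left.
suff -> : (x |` A) `\ x = A by [].
apply/seteqP; split=> [y [[->|]] // /(_ erefl)//|y Ay]; split; first by right.
by move=> yx; apply: nAx; rewrite -yx.
Qed.

Lemma card_setD1 (T : Type) (x : T) (A : set T) n :
  ~ A x -> x |` A #= `I_n.+1 -> A #= `I_n.
Proof.
move=> nAx xAn; have : finite_set A.
  by apply: (@sub_finite_set _ _ (x |` A)); [right | apply/finite_setP; exists n.+1].
move=> /finite_setP[m Am]; have := card_setU1 nAx Am.
by rewrite (card_eql xAn) => /card_eq_II [->].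
Qed.

Lemma card_subset (T : Type) (A : set T) n :
  `I_n #<= A -> exists2 B, B `<=` A & B #= `I_n.
Proof.
by move=> /card_subP[B nB BA]; exists B => //; rewrite card_eq_sym.
Qed.

Lemma card_subset_eq (T : choiceType) (A B : set T) n :
  A `<=` B -> A #= `I_n -> B #= `I_n -> A = B.
Proof.
move=> AB An Bn.
have fA : finite_set A by apply/finite_setP; exists n.
have fB : finite_set B by apply/finite_setP; exists n.
apply: fset_set_inj => //; apply/eqP; rewrite eqEfcard.
rewrite (card_fset_set An) (card_fset_set Bn) leqnn andbT.
by move: AB; rewrite fset_set_sub.
Qed.

Lemma card_add_II (T U : Type) (A : set T) (B : set U) m n :
  A #= `I_m -> B #= `I_n -> card_add A B #= `I_(m + n).
Proof.
move=> + Bn; elim: m A => [|m IH] A.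
  rewrite II0 card_eq0 => /eqP->.
  rewrite /card_add image_set0 set0U add0n; apply: card_eq_trans Bn.
  by apply: inj_card_eq => x y _ _ [].
move=> /eq_cardSP[x Ax /IH AxB]; rewrite addSn; apply/eq_cardSP.
exists (inl x); first by left; exists x.
suff -> : card_add A B `\ inl x = card_add (A `\ x) B by [].
apply/seteqP; split=> [_ [[[y Ay <-]|[y By <-]] ne]|_ [[y [Ay ne] <-]|[y By <-]]].
- by left; exists y => //; split=> // yx; apply: ne; rewrite yx.
- by right; exists y.
- by split; [left; exists y|move=> [/ne]].
- by split=> //; right; exists y.
Qed.

(** Turns the modular law, an equality of cardinals, into an equality of
    natural numbers; that the terms on the right are finite comes for free. *)
Lemma card_add_sum (T : Type) (A B C D : set T) m n :
    A #= `I_m -> B #= `I_n -> card_add A B #= card_add C D ->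
  exists p q, [/\ C #= `I_p, D #= `I_q & m + n = p + q]%N.
Proof.
move=> Am Bn ABCD; have CDmn := card_add_II Am Bn; rewrite (card_eql ABCD) in CDmn.
have fin : finite_set (card_add C D) by apply/finite_setP; exists (m + n)%N.
have /finite_setP[p Cp] : finite_set C.
  have : finite_set (@inl T T @` C) by apply: sub_finite_set fin; left.
  by rewrite (eq_finite_set (_ : _ #= C))//; apply: inj_card_eq => x y _ _ [].
have /finite_setP[q Dq] : finite_set D.
  have : finite_set (@inr T T @` D) by apply: sub_finite_set fin; right.
  by rewrite (eq_finite_set (_ : _ #= D))//; apply: inj_card_eq => x y _ _ [].
exists p, q; split=> //; apply/card_eq_II.
by rewrite -(card_eql CDmn) card_add_II.
Qed.

(** When [`I_k] is the minimum and [A #<= C], one needs that two cardinals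
    are comparable; this is elementary since one of them is finite. *)
Lemma card_min_le (T V : Type) (A : set T) k (C : set V) :
  card_min A `I_k #<= C <-> A #<= C \/ `I_k #<= C.
Proof.
have inlA : @inl T nat @` A #= A by apply: inj_card_eq => x y _ _ [].
have inrk : @inr T nat @` `I_k #= `I_k by apply: inj_card_eq => x y _ _ [].
rewrite /card_min; case: ifPn => Ak.
  rewrite (card_le_eql inlA); split=> [|[//|kC]]; first by left.
  exact: card_le_trans kC.
rewrite (card_le_eql inrk); split=> [|[AC|//]]; first by right.
have [/finite_setP[n An]|/infiniteP natA] := pselect (finite_set A).
  apply: card_le_trans AC.
  move: Ak; rewrite (card_le_eql An) (card_le_eqr An) !card_le_II -ltnNge.
  exact: ltnW.
exact: card_le_trans (card_le_trans (card_leT _) natA) AC.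
Qed.

End finite_cardinals.

(** * Bases, ranks and closures in finite rank *)

Section matroid_theory.
Variables (E : choiceType) (M : finitary_matroid E).
Implicit Types A B C I : set E.

Lemma is_basis_indep B : indep M B -> is_basis M B B.
Proof. by move=> IB; split=> // C _ BC CB; apply/seteqP. Qed.

Lemma rank_indep B : indep M B -> rank M B = B.
Proof. by move=> IB; have [RB _ Rmax] := rankP M B; rewrite -(Rmax _ IB RB). Qed.

Lemma basis_memP A B x : is_basis M A B -> A x -> indep M (x |` B) -> B x.
Proof.
move=> [BA _ Bmax] Ax IxB; rewrite -(Bmax _ IxB); first by left.
- by move=> y; right.
- by move=> y [->|/BA].
Qed.

Lemma indep_le_basis A B C n :
  is_basis M A B -> B #= `I_n -> C `<=` A -> indep M C -> C #<= `I_n.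
Proof.
move=> bB Bn CA IC; have [BA IB _] := bB.
have [//|CnI] := boolP (C #<= `I_n); exfalso.
have nC : `I_n.+1 #<= C.
  have [/finite_setP[m Cm]|/infiniteP natC] := pselect (finite_set C).
    by move: CnI; rewrite (card_le_eql Cm) (card_le_eqr Cm) !card_le_II -ltnNge.
  exact: card_le_trans (card_leT _) natC.
have [D DC Dn] := card_subset nC.
have [x [[Dx nBx] IxB]] := indep_exch IB (indep_sub IC DC) Bn Dn.
by apply: nBx; apply: basis_memP bB _ IxB; exact/CA/DC.
Qed.

Lemma basis_card A B C n :
  is_basis M A B -> is_basis M A C -> B #= `I_n -> C #= `I_n.
Proof.
move=> bB bC Bn; have [BA IB _] := bB; have [CA IC _] := bC.
have Cn := indep_le_basis bB Bn CA IC.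
have /finite_setP[m Cm] : finite_set C by apply/finite_set_leP; exists n.
have nm := indep_le_basis bC Cm BA IB.
rewrite (card_le_eql Bn) in nm; rewrite (card_le_eql Cm) in Cn.
by rewrite !card_le_II in nm Cn; rewrite (eqP (_ : n == m)) // eqn_leq nm.
Qed.

Lemma basis_rank A B n : is_basis M A B -> (rank M A #= `I_n) = (B #= `I_n).
Proof.
move=> bB; have bR := rankP M A.
by apply/idP/idP; [exact: basis_card bR bB|exact: basis_card bB bR].
Qed.

Lemma basis_of_card A B C n : is_basis M A B -> B #= `I_n ->
  C `<=` A -> indep M C -> C #= `I_n -> is_basis M A C.
Proof.
move=> bB Bn CA IC Cn; split=> // D ID CD DA; apply/esym.
have Dn := indep_le_basis bB Bn DA ID.
have /finite_setP[m Dm] : finite_set D by apply/finite_set_leP; exists n.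
apply: (card_subset_eq CD Cn).
have := subset_card_le CD.
rewrite (card_le_eql Cn) (card_le_eqr Dm) card_le_II => nm.
rewrite (card_le_eql Dm) card_le_II in Dn.
by rewrite (eqP (_ : n == m)) // eqn_leq nm.
Qed.

(** Iterated exchange: [B] is only used through a subset of cardinal one more
    than that of [A], which is what the exchange axiom asks for. *)
Lemma indep_augment A B m n : indep M A -> indep M B ->
    A #= `I_m -> B #= `I_n -> (m <= n)%N ->
  exists C, [/\ A `<=` C, C `<=` A `|` B, indep M C & C #= `I_n].
Proof.
move=> + IB + Bn; have [k] := ubnP (n - m); elim: k m A => // k IH m A lt IA Am.
rewrite leq_eqVlt => /orP[/eqP mn|mn].
  by exists A; split=> //; rewrite -mn.
have [|D DB Dm] := @card_subset _ B m.+1.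
  by rewrite (card_le_eqr Bn) card_le_II.
have [x [[Dx nAx] IxA]] := indep_exch IA (indep_sub IB DB) Am Dm.
have [|C [AC CAB IC Cn]] := IH m.+1 _ _ IxA (card_setU1 nAx Am) mn.
  by rewrite subnS -ltnS prednK ?subn_gt0.
exists C; split=> //; first by move=> y Ay; apply: AC; right.
by move=> y /CAB[[->|Ay]|By]; [right; exact: DB|left|right].
Qed.

Lemma basis_extend A B I n : is_basis M A B -> B #= `I_n ->
  indep M I -> I `<=` A -> exists2 C, is_basis M A C & I `<=` C.
Proof.
move=> bB Bn II IA; have [BA IB _] := bB.
have In := indep_le_basis bB Bn IA II.
have /finite_setP[m Im] : finite_set I by apply/finite_set_leP; exists n.
rewrite (card_le_eql Im) card_le_II in In.
have [C [IC CIB indC Cn]] := indep_augment II IB Im Bn In.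
exists C => //; apply: basis_of_card bB Bn _ indC Cn.
by move=> x /CIB[/IA|/BA].
Qed.

(** The definition of [cl] lets the independent witness [D] vary.  Any basis
    [B] may serve instead: were [x |` B] independent, with one element more
    than [A] can contain, augmenting [D] from [x |` B] would have to use [x],
    so that [x |` D] would be independent too. *)
Lemma clP A B n x : is_basis M A B -> B #= `I_n ->
  cl M A x <-> (indep M (x |` B) -> B x).
Proof.
move=> bB Bn; have [BA IB _] := bB; split=> [|clx].
  move=> [Ax|[nAx [D [ID DA nIxD]]]]; first exact: basis_memP bB Ax.
  move=> IxB; apply: contrapT => nBx; apply: nIxD.
  have Dn := indep_le_basis bB Bn DA ID.
  have /finite_setP[m Dm] : finite_set D by apply/finite_set_leP; exists n.
  rewrite (card_le_eql Dm) card_le_II in Dn.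
  have [C [DC CDxB IC Cn]] :=
    indep_augment ID IxB Dm (card_setU1 nBx Bn) (leqW Dn).
  apply: (indep_sub IC) => y [->|/DC//]; apply: contrapT => nCx.
  have CA : C `<=` A.
    by move=> z Cz; have [/DA|[zx|/BA]] := CDxB z Cz => //; case: nCx; rewrite -zx.
  by have := indep_le_basis bB Bn CA IC; rewrite (card_le_eql Cn) card_le_II ltnn.
have [Ax|nAx] := pselect (A x); first by left.
by right; split=> //; exists B; split=> // /clx/BA.
Qed.

Lemma sub_cl A : A `<=` cl M A. Proof. by move=> x; left. Qed.

Lemma cl_mono A B : A `<=` B -> cl M A `<=` cl M B.
Proof.
move=> AB x [/AB|[_ [C [IC CA nI]]]]; first by left.
have [Bx|nBx] := pselect (B x); first by left.
by right; split=> //; exists C; split=> //; exact: subset_trans AB.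
Qed.

Lemma cl_sub_flat A B : is_flat M B -> A `<=` B -> cl M A `<=` B.
Proof. by move=> fB AB x /(cl_mono AB); rewrite fB. Qed.

Lemma basis_cl A B n : is_basis M A B -> B #= `I_n -> is_basis M (cl M A) B.
Proof.
move=> bB Bn; have [BA IB _] := bB; split=> //.
  exact: subset_trans BA (@sub_cl A).
move=> C IC BC CA; apply/seteqP; split=> // x Cx.
apply: (clP x bB Bn).1; first exact: CA.
by apply: (indep_sub IC) => y [->|/BC].
Qed.

Lemma cl_rank A n : rank M A #= `I_n -> rank M (cl M A) #= `I_n.
Proof. by move=> An; rewrite (basis_rank _ (basis_cl (rankP M A) An)). Qed.

Lemma cl_flat A n : rank M A #= `I_n -> is_flat M (cl M A).
Proof.
move=> An; apply/seteqP; split=> x; last exact: sub_cl.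
rewrite (clP _ (basis_cl (rankP M A) An) An) => clx.
by rewrite (clP _ (rankP M A) An).
Qed.

Lemma basis_subset_cl A B n : is_basis M A B -> B #= `I_n -> A `<=` cl M B.
Proof.
move=> bB Bn x Ax; have [_ IB _] := bB.
by rewrite (clP _ (is_basis_indep IB) Bn); exact: basis_memP bB Ax.
Qed.

Lemma flatI A B : is_flat M A -> is_flat M B -> is_flat M (A `&` B).
Proof.
move=> fA fB; apply/seteqP; split; last exact: sub_cl.
by move=> x ABx; split; [rewrite -fA|rewrite -fB]; apply: cl_mono ABx => y [].
Qed.

Lemma rank_sub A B n : A `<=` B -> rank M B #= `I_n ->
  exists2 m, (m <= n)%N & rank M A #= `I_m.
Proof.
move=> AB Bn; have [RA IR _] := rankP M A.
have Rn := indep_le_basis (rankP M B) Bn (subset_trans RA AB) IR.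
have /finite_setP[m Rm] : finite_set (rank M A) by apply/finite_set_leP; exists n.
by exists m => //; rewrite (card_le_eql Rm) card_le_II in Rn.
Qed.

(** A flat is determined, among the finite-rank sets around it, by its rank:
    a basis of [A] is then also a basis of [B]. *)
Lemma flat_rank_eq A B n : is_flat M A -> A `<=` B ->
  rank M A #= `I_n -> rank M B #= `I_n -> A = B.
Proof.
move=> fA AB An Bn; apply/seteqP; split=> // x Bx; rewrite -fA.
have [RA IR _] := rankP M A.
have bB := basis_of_card (rankP M B) Bn (subset_trans RA AB) IR An.
by rewrite (clP _ (rankP M A) An); exact: basis_memP bB Bx.
Qed.

Lemma nrank_card A n : rank M A #= `I_n -> nrank M A = n.
Proof. exact: card_fset_set. Qed.

End matroid_theory.

(** * Translations *)

Section translations.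
Variables (G : groupType) (M : finitary_matroid G).
Hypothesis GM : independence_group M.
Implicit Types (A B C X Y : set G) (g h x y : G).

Lemma ltranslateE g A x : ltranslate g A x <-> A (g^-1 * x)%g.
Proof.
split=> [[a Aa <-]|Agx]; first by rewrite mulKg.
by exists (g^-1 * x)%g; rewrite ?mulVKg.
Qed.

Lemma ltranslateK g A : ltranslate g^-1%g (ltranslate g A) = A.
Proof. by apply/seteqP; split=> x; rewrite !ltranslateE invgK mulKg. Qed.

Lemma ltranslateS g A B : A `<=` B -> ltranslate g A `<=` ltranslate g B.
Proof. by move=> AB x; rewrite !ltranslateE => /AB. Qed.

Lemma ltranslateU1 g x A :
  ltranslate g (x |` A) = (g * x)%g |` ltranslate g A.
Proof. by rewrite /ltranslate image_setU image_set1. Qed.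

Lemma ltranslate_card g A n : (ltranslate g A #= `I_n) = (A #= `I_n).
Proof. by apply/card_eql/inj_card_eq => x y _ _ /mulgI. Qed.

Lemma ltranslate_basis g A B :
  is_basis M A B -> is_basis M (ltranslate g A) (ltranslate g B).
Proof.
move=> [BA IB Bmax]; split; [exact: ltranslateS|exact/GM|].
move=> C IC BC CA; rewrite -(Bmax (ltranslate g^-1%g C)).
- by rewrite -{1}(invgK g) ltranslateK.
- exact/GM.
- by rewrite -(ltranslateK g B); exact: ltranslateS.
- by rewrite -(ltranslateK g A); exact: ltranslateS.
Qed.

Lemma ltranslate_rank g A n : rank M A #= `I_n ->
  rank M (ltranslate g A) #= `I_n.
Proof.
by move=> An; rewrite (basis_rank _ (ltranslate_basis g (rankP M A))) ltranslate_card.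
Qed.

Lemma cl_ltranslate g A x : cl M A x -> cl M (ltranslate g A) (g * x)%g.
Proof.
move=> [Ax|[nAx [D [ID DA nI]]]]; first by left; rewrite ltranslateE mulKg.
right; split; first by rewrite ltranslateE mulKg.
exists (ltranslate g D); split; [exact/GM|exact: ltranslateS|].
by rewrite -ltranslateU1 => /GM.
Qed.

Lemma flat_ltranslate g A : is_flat M A -> is_flat M (ltranslate g A).
Proof.
move=> fA; apply/seteqP; split; last exact: sub_cl.
move=> x /(cl_ltranslate g^-1%g); rewrite ltranslateK fA => Agx.
by apply/ltranslateE.
Qed.

End translations.

(** * From the rank inequality to matchings *)

Section rank_inequality_to_matching.
Variables (G : groupType) (M : finitary_matroid G).

(** Hall's condition for the relation [x y \notin A] between two bases; a
    violating [S] contradicts the inequality for [S] and [1 |` T]. *)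
Lemma rank_inequality_matching :
  (forall X Y : set G, X !=set0 -> Y !=set0 ->
     finite_rank M X -> finite_rank M Y ->
     card_min (rank M [set: G]) `I_(nrank M X + nrank M Y - 1)
       #<= rank M (setprod X Y)) ->
  matching_property M.
Proof.
move=> ineq A B fA fB /finite_setP[n An] _ rAB B1 a b ba bb.
have Bn : rank M B #= `I_n by rewrite -(card_eql rAB).
have an : a #= `I_n by rewrite -(basis_rank _ ba).
have bn : b #= `I_n by rewrite -(basis_rank _ bb).
have [aA Ia _] := ba; have [bB Ib _] := bb.
have fina : finite_set a by apply/finite_setP; exists n.
have finb : finite_set b by apply/finite_setP; exists n.
have Ib1 : indep M (1%g |` b).
  by apply: contrapT => nI; apply: B1; rewrite -fB (clP _ bb bn).
(* otherwise the flat B, of rank n, would be the whole group *)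
have GB : ~ (rank M [set: G] #<= `I_n).
  move=> Gn; apply: B1.
  have /finite_setP[m Gm] : finite_set (rank M [set: G]).
    by apply/finite_set_leP; exists n.
  rewrite (card_le_eql Gm) card_le_II in Gn.
  have [k km Bk] := rank_sub (@subsetT _ B) Gm.
  have {Bk}kn : k = n by apply/card_eq_II; rewrite -(card_eql Bk).
  have mn : m = n by apply/eqP; rewrite eqn_leq Gn -kn.
  by rewrite (flat_rank_eq fB (@subsetT _ B) Bn) // -mn.
pose r (x y : G) := ~~ `[< A (x * y)%g >].
(* the default value 1 only matters when a is empty: any function will do *)
have [S Sa|f [f_inj fP]] := @hall _ _ r (fset_set a) (fset_set b) 1%g.
  set N := neighbours r S (fset_set b).
  have [->|/fset0Pn[s sS]] := eqVneq S fset0; first by rewrite cardfs0.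
  rewrite leqNgt; apply/negP => NS.
  have Nb : (N `<=` fset_set b)%fset by apply/fsubsetP => y /neighboursP[].
  pose T := (fset_set b `\` N)%fset; pose Y := 1%g |` [set` T].
  have cT : #|` T| = (n - #|` N|)%N by rewrite cardfsDS// (card_fset_set bn).
  have Ssub : [set` S] `<=` a.
    by move=> x /(fsubsetP Sa); rewrite in_fset_set// inE.
  have Tb y : y \in T -> b y /\ y \notin N.
    by rewrite inE in_fset_set// => /andP[-> /[!inE]].
  have IS : indep M [set` S] := indep_sub Ia Ssub.
  have IY : indep M Y by apply: indep_sub Ib1 _ => y [|/Tb[]]; [left|right].
  have cS : [set` S] #= `I_#|` S| by apply/card_eq_fsetP.
  have cY : Y #= `I_#|` T|.+1.
    by apply: card_setU1; [move=> /Tb[/bB]|apply/card_eq_fsetP].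
  have := ineq [set` S] Y.
  rewrite /finite_rank (nrank_card (n := #|` S|)) ?(rank_indep IS)//.
  rewrite (nrank_card (n := #|` T|.+1)) ?(rank_indep IY)//.
  have SYA : setprod [set` S] Y `<=` A.
    move=> _ [x xS [y [->|yT] <-]]; first by rewrite mulg1; exact/aA/Ssub.
    have [yb /negP yN] := Tb _ yT; apply: contrapT => nA; apply: yN.
    apply/neighboursP; split; first by rewrite in_fset_set ?inE.
    by exists x => //; exact/asboolPn.
  have [m mn SYm] := rank_sub SYA An.
  move=> /(_ _ _ _ _)/card_min_le[|||||].
  - by exists s.
  - by exists 1%g; left.
  - by apply/finite_setP; eexists; exact: cS.
  - by apply/finite_setP; eexists; exact: cY.
  - move=> le; apply: GB; apply: card_le_trans le _.
    by rewrite (card_le_eql SYm) card_le_II.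
  - rewrite (card_le_eqr SYm) card_le_II addnS subn1 /= cT => le.
    have Nn : (#|` N| <= n)%N by rewrite -(card_fset_set bn) fsubset_leq_card.
    have := leq_trans le mn; rewrite leqNgt => /negP; apply.
    by rewrite -{1}(subnKC Nn) ltn_add2r.
have faP x : x \in fset_set a <-> a x by rewrite in_fset_set ?inE.
have fbP x : x \in fset_set b <-> b x by rewrite in_fset_set ?inE.
have fab : f @` a `<=` b by move=> _ [x /faP/fP[/fbP fx _] <-].
exists f; split=> [|x /faP/fP[_ /asboolPn]//].
have finj x y : x \in a -> y \in a -> f x = f y -> x = y.
  by rewrite !inE => /faP xa /faP ya; exact: f_inj.
split=> //; first by move=> x ax; apply: fab; exists x.
rewrite /set_surj (card_subset_eq fab _ bn)//.
by rewrite (card_eql (inj_card_eq finj)).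
Qed.
End rank_inequality_to_matching.

(** * From matchings to the rank inequality *)

Section matching_to_rank_inequality.
Variables (G : groupType) (M : finitary_matroid G).
Hypotheses (GM : independence_group M) (Mmod : modular M).
Hypotheses (Gab : abelian_group G) (Gmatch : matching_property M).
Implicit Types (A B C H X Y : set G).

(** If [x] were outside [H], trading [1] for [x] in a basis of [H] would give
    a flat of the same rank without [1].  Its basis still has an element [y]
    in [H], because the rank is at least 2, and [y] is the partner of some [z]
    in [H] although [z y] is in [H]. *)
Lemma flat_submonoid_full H n : is_flat M H -> rank M H #= `I_n -> (1 < n)%N ->
  H 1%g -> (forall x y, H x -> H y -> H (x * y)%g) -> H = [set: G].
Proof.
move=> fH Hn n1 H1 HM; apply: contrapT => HnT.
have [x nHx] : exists x, ~ H x.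
  by apply/existsNP => HT; apply: HnT; apply/seteqP; split=> // x _; exact: HT.
(* some singleton is independent, hence all of them, by translation *)
have I1 : indep M [set 1%g].
  have [RH IR _] := rankP M H.
  have [z Rz] := card_gt0 Hn (ltnW n1).
  apply/(GM z); apply: indep_sub IR _ => _ [_ -> <-]; by rewrite mulg1.
have [b bH b1] : exists2 b, is_basis M H b & [set 1%g] `<=` b.
  by apply: basis_extend (rankP M H) Hn I1 _ => _ ->.
have bn : b #= `I_n by rewrite -(basis_rank _ bH).
have [bsub Ib _] := bH.
pose h := b `\ 1%g.
have hb : h `<=` b by move=> y [].
have b1h : b = 1%g |` h by rewrite setD1K//; exact: b1.
have h1 : ~ h 1%g by case=> _ /(_ erefl).
have nhx : ~ h x by move=> /hb/bsub.
case: n bn Hn n1 => // k bn Hn k0.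
have hk : h #= `I_k by apply: (card_setD1 h1); rewrite -b1h.
have [y hy] := card_gt0 hk k0.
have Ixb : indep M (x |` b).
  apply: contrapT => nI; apply: nHx; rewrite -fH.
  by rewrite (clP _ bH bn).
pose b' := x |` h.
have b'k : b' #= `I_k.+1 by exact: card_setU1.
have Ib' : indep M b' by apply: indep_sub Ixb _ => z [|/hb]; [left|right].
have bb' := is_basis_indep Ib'.
have rb' : rank M b' #= `I_k.+1 by rewrite (basis_rank _ bb').
have n1b' : ~ cl M b' 1%g.
  rewrite (clP _ bb' b'k) => /(_ _)[|x1|/h1//].
    by apply: indep_sub Ixb _ => z [->|[|/hb]]; [right; exact: b1|left|right].
  by apply: nHx; rewrite -x1.
have [|||f [[fb finj fsurj] fH']] := Gmatch fH (cl_flat rb') _ _ _ n1b' bH (basis_cl bb' b'k).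
- by apply/finite_setP; eexists; exact: Hn.
- by apply/finite_setP; eexists; exact: cl_rank rb'.
- by rewrite (card_eql Hn) card_eq_sym cl_rank.
have [z bz fz] := fsurj y (or_intror hy).
by apply: (fH' z bz); rewrite fz; apply: HM; apply: bsub => //; exact: hb.
Qed.

(** Induction on the rank of [B] by Dyson's transform.  The flat [C] stays
    the same throughout, which is why the statement bounds the rank of any
    flat containing the products rather than that of the products. *)
Lemma cauchy_davenport_flats n m c A B C :
    is_flat M A -> is_flat M B -> is_flat M C ->
    rank M A #= `I_m -> rank M B #= `I_n -> rank M C #= `I_c ->
    A !=set0 -> B !=set0 -> (forall a b, A a -> B b -> C (a * b)%g) ->
  C = [set: G] \/ (m + n - 1 <= c)%N.
Proof.
have [k] := ubnP n; elim: k n m A B => // k IH n m A B ltnk.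
move=> fA fB fC Am Bn Cc [a0 Aa0] [b0 Bb0] ABC.
have [/existsNP[a /existsNP[b /existsNP[b' /not_implyP[Aa /not_implyP[Bb
      /not_implyP[Bb' nA]]]]]]|stuck] := pselect (~ forall a b b',
    A a -> B b -> B b' -> A (a * b^-1 * b')%g).
  pose e := (a * b^-1)%g.
  pose eB := ltranslate e B.
  have feB : is_flat M eB := flat_ltranslate GM e fB.
  have [p [q [AUp AIq mnpq]]] :=
    card_add_sum Am (ltranslate_rank GM e Bn) (Mmod fA feB).
  pose B' := ltranslate e^-1%g (A `&` eB).
  have B'E x : B' x <-> A (e * x)%g /\ B x.
    split=> [[z [Az [y By yz]] <-]|[Aex Bx]]; first by rewrite mulVKg -yz mulKg yz.
    by exists (e * x)%g; [split=> //; exists x|rewrite mulKg].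
  have fB' : is_flat M B' by apply: flat_ltranslate => //; exact: flatI.
  have B'q : rank M B' #= `I_q := ltranslate_rank GM _ AIq.
  have B'B : B' `<=` B by move=> x /B'E[].
  have ltqn : (q < n)%N.
    have [j jn] := rank_sub B'B Bn; rewrite (card_eql B'q) => /card_eq_II qj.
    rewrite ltn_neqAle qj jn andbT; apply/eqP => jn'.
    apply: nA; suff /B'E[] : B' b' by [].
    by rewrite (flat_rank_eq fB' B'B B'q)// qj jn'.
  rewrite mnpq; apply: (IH q p (cl M (A `|` eB)) B') => //.
  - exact: leq_trans ltqn _.
  - exact: cl_flat AUp.
  - exact: cl_rank AUp.
  - by exists a0; apply: sub_cl; left.
  - by exists b; apply/B'E; rewrite mulgVK.
  move=> x y Ux /B'E[Aey By]; rewrite Gab.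
  apply: (cl_sub_flat fC _ (cl_ltranslate GM y Ux)) => _ [z [Az|[w Bw <-]] <-].
    by rewrite Gab; exact: ABC.
  by rewrite mulgA (Gab y); exact: ABC.
(* No transform shrinks B any more: a / b * B is inside A for all a and b. *)
move/contrapT in stuck.
have leqmc : (m <= c)%N.
  have AbC : ltranslate b0 A `<=` C.
    by move=> _ [a Aa <-]; rewrite Gab; exact: ABC.
  have [j jc] := rank_sub AbC Cc.
  by rewrite (card_eql (ltranslate_rank GM b0 Am)) => /card_eq_II ->.
have [n1|n1] := leqP n 1.
  by right; apply: leq_trans leqmc; rewrite leq_subLR addnC leq_add2r.
(* H is the intersection of the flats a^-1 A, and contains b0^-1 B. *)
left; pose H := [set h | forall a, A a -> A (a * h)%g].
have HA a : A a -> H `<=` ltranslate a^-1%g A.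
  by move=> Aa h Hh; rewrite ltranslateE invgK; exact: Hh.
have fH : is_flat M H.
  apply/seteqP; split; last exact: sub_cl.
  move=> x clx a Aa; have := cl_mono (HA a Aa) clx.
  by rewrite flat_ltranslate// ltranslateE invgK.
have BH : ltranslate b0^-1%g B `<=` H.
  by move=> _ [b Bb <-] a Aa; rewrite mulgA; exact: stuck.
have [h _ Hh] := rank_sub (HA _ Aa0) (ltranslate_rank GM _ Am).
have nh : (n <= h)%N.
  have [j jh] := rank_sub BH Hh.
  by rewrite (card_eql (ltranslate_rank GM _ Bn)) => /card_eq_II ->.
have HT : H = [set: G].
  apply: (flat_submonoid_full fH Hh (leq_trans n1 nh)).
    by move=> a Aa; rewrite mulg1.
  by move=> x y Hx Hy a Aa; rewrite mulgA; exact/Hy/Hx.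
(* As A h is inside A for every h, x is the product of a point of A by b0. *)
apply/seteqP; split=> // x _.
have /(_ a0 Aa0) : H (a0^-1 * x * b0^-1)%g by rewrite HT.
by rewrite -mulgA mulVKg => /ABC/(_ Bb0); rewrite mulgVK.
Qed.

(** The closures may be taken one factor at a time, since the translate of a
    closure is the closure of the translate. *)
Lemma cl_setprod X Y C a b : is_flat M C -> setprod X Y `<=` C ->
  cl M X a -> cl M Y b -> C (a * b)%g.
Proof.
move=> fC XYC Xa; have aY y : Y y -> C (a * y)%g.
  move=> Yy; rewrite Gab; apply: (cl_sub_flat fC _ (cl_ltranslate GM y Xa)).
  by move=> _ [x Xx <-]; rewrite Gab; apply: XYC; exists x => //; exists y.
move=> Yb; apply: (cl_sub_flat fC _ (cl_ltranslate GM a Yb)).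
by move=> _ [y Yy <-]; exact: aY.
Qed.

(** The product set of two bases is finite and spans the product set, hence
    gives a finite-rank flat to which [cauchy_davenport_flats] applies. *)
Lemma matching_rank_inequality X Y : X !=set0 -> Y !=set0 ->
    finite_rank M X -> finite_rank M Y ->
  card_min (rank M [set: G]) `I_(nrank M X + nrank M Y - 1)
    #<= rank M (setprod X Y).
Proof.
move=> [x0 Xx0] [y0 Yy0] /[dup] finx /finite_setP[m Xm] /[dup] finy /finite_setP[n Yn].
rewrite (nrank_card Xm) (nrank_card Yn); apply/card_min_le.
pose S := setprod (rank M X) (rank M Y); pose C := cl M S.
have finS : finite_set S by exact: finite_image2.
have [s Ss] : exists s, rank M S #= `I_s.
  by apply/finite_setP; apply: sub_finite_set finS; have [] := rankP M S.
have fC : is_flat M C := cl_flat Ss.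
have CP a b : cl M X a -> cl M Y b -> C (a * b)%g.
  have cl_rank_sub Z k : rank M Z #= `I_k -> cl M Z `<=` cl M (rank M Z).
    by move=> Zk; exact: basis_subset_cl (basis_cl (rankP M Z) Zk) Zk.
  move=> /(cl_rank_sub _ _ Xm) Xa /(cl_rank_sub _ _ Yn) Yb.
  by apply: cl_setprod Xa Yb => //; exact: sub_cl.
have SXY : S `<=` setprod X Y.
  have [RX _ _] := rankP M X; have [RY _ _] := rankP M Y.
  by move=> _ [x Rx [y Ry <-]]; exists x; [exact: RX|exists y => //; exact: RY].
have XYC : setprod X Y `<=` C.
  by move=> _ [x Xx [y Yy <-]]; apply: CP; exact: sub_cl.
have [t ts XYt] := rank_sub XYC (cl_rank Ss).
have {ts} st : (s <= t)%N.
  by have [j jt] := rank_sub SXY XYt; rewrite (card_eql Ss) => /card_eq_II ->.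
have [||CT|mns] := cauchy_davenport_flats (cl_flat Xm) (cl_flat Yn) fC
  (cl_rank Xm) (cl_rank Yn) (cl_rank Ss) _ _ CP.
- by exists x0; exact: sub_cl.
- by exists y0; exact: sub_cl.
- left; rewrite -CT (card_le_eql (cl_rank Ss)) (card_le_eqr XYt).
  by rewrite card_le_II.
- by right; rewrite (card_le_eqr XYt) card_le_II (leq_trans mns).
Qed.

End matching_to_rank_inequality.

Theorem corollary7p17 (G : groupType) (M : finitary_matroid G)
    (GM : modular_abelian_independence_group M) :
  matching_property M <->
  (forall X Y : set G, X !=set0 -> Y !=set0 ->
     finite_rank M X -> finite_rank M Y ->
     card_min (rank M [set: G]) `I_(nrank M X + nrank M Y - 1)
       #<= rank M (setprod X Y)).
Proof.
have [GI Gmod Gab] := GM; split; last exact: rank_inequality_matching.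
by move=> Gmatch X Y; exact: matching_rank_inequality.
Qed.
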